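(* Let $m\in\mathbb{N}\setminus\{0\}$. For every $n\in\{1,\ldots,m\}$ and $i\in\{1,\ldots,n\}$, let $$a_{i,n}=\frac12\sup_{p\in\mathbb{N}}\left(\beta_{i,n,p}^2+\widetilde\beta_{i,n,p}^2+\eta_{i,n}^2+\sqrt{(\beta_{i,n,p}^2+\widetilde\beta_{i,n,p}^2+\eta_{i,n}^2)^2-4\beta_{i,n,p}^2\eta_{i,n}^2}\right).$$ Set $\theta_0=1$ and define recursively $$\theta_n=\sum_{i=1}^n\theta_{i-1}\sqrt{a_{i,n}}\qquad(n\in\{1,\ldots,m\}).$$ Then $\theta_m/2^{m-1}$ is a Lipschitz constant of the virtual network $S=Q_m\circ U_m\circ\cdots\circ Q_1\circ U_1:\mathcal{X}\times\mathcal{X}\to\mathcal{X}\times\mathcal{X}$.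
   Context: $\mathcal{X},\mathcal{Y}$ are real Hilbert spaces of functions on $]0,1[$ (typically $L^2(0,1)$); $T:\mathcal{X}\to\mathcal{Y}$ is a compact linear integral operator $(Tx)(t)=\int_0^1 k(t,s)x(s)\,ds$ with $k\in L^2([0,1]^2)$; $D$ is a bounded linear operator from $\mathcal{X}$ to a real Hilbert space. $T^*T$ and $D^*D$ commute and are diagonalized in a common orthonormal basis $(v_p)_{p\in\mathbb{N}}$ of $\mathcal{X}$, with eigenvalues $(\beta_{T,p})_p$ and $(\beta_{D,p})_p$ respectively. $g:\mathcal{X}\to\,]-\infty,+\infty]$ is proper, lower semicontinuous and convex. For $n\in\{1,\ldots,m\}$, $\lambda_n,\mu_n,\tau_n,\eta_n$ are positive reals. $\mathrm{Id}$ is the identity. The proximity operator is $\mathrm{prox}_{f}(x)=\operatorname{argmin}_{y}\,(f(y)+\frac12\|x-y\|^2)$. $R_n=\mathrm{prox}_{\lambda_n\mu_ng}$, $W_n=\mathrm{Id}-\lambda_nT^*T-\lambda_n\tau_nD^*D$ on $\mathcal{X}$. On $\mathcal{X}\times\mathcal{X}$, with norm $\|(x,b)\|=\sqrt{\|x\|^2+\|b\|^2}$: $U_n(x,b)=(W_nx+\lambda_nb,\ \eta_nb)$ and $Q_n(x,b)=(R_nx,\ b)$. For $1\le i\le n\le m$ and $p\in\mathbb{N}$: $\beta_p^{(n)}=1-\lambda_n(\beta_{T,p}+\tau_n\beta_{D,p})$; $\beta_{i,n,p}=\prod_{j=i}^n\beta_p^{(j)}$; $\eta_{i,j}=\eta_j\cdots\eta_i$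 if $j\ge i$ and $\eta_{i,j}=1$ otherwise; $\widetilde\beta_{i,n,p}=\sum_{j=i}^{n-1}\beta_p^{(n)}\cdots\beta_p^{(j+1)}\lambda_j\eta_{i,j-1}+\lambda_n\eta_{i,n-1}$ (an empty sum is $0$). *)

(* Defs.v *)
From HB Require Import structures.
From mathcomp Require Import all_boot all_order all_algebra.
From mathcomp Require Import all_classical all_reals all_analysis.

Set Implicit Arguments.
Unset Strict Implicit.
Unset Printing Implicit Defensive.

Import Order.TTheory GRing.Theory Num.Theory.
Import numFieldNormedType.Exports.

Local Open Scope classical_set_scope.
Local Open Scope ring_scope.

HB.mixin Record isHilbert (R : realType) V of CompleteNormedModule R V := {
  inner : {dot V for (@idfun R)} ;
  innerE : forall x : V, inner x x = `|x| ^+ 2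
}.

#[short(type="hilbertType")]
HB.structure Definition Hilbert (R : realType) :=
  {V of isHilbert R V & CompleteNormedModule R V}.

Section Hilbert_notions.
Context {R : realType}.

(* For bounded linear A the set below is a singleton (Riesz). *)
Definition adjoint {X Y : hilbertType R} (A : X -> Y) : Y -> X :=
  xget (fun=> 0)
    [set B : Y -> X | forall x y, inner (A x) y = inner x (B y)].

Definition orthonormal_basis {X : hilbertType R} (v : nat -> X) :=
  (forall p q, inner (v p) (v q) = (p == q)%:R) /\
  (forall x, series (fun p => inner x (v p) *: v p) @ \oo --> x).

Definition compact_operator {X Y : hilbertType R} (A : X -> Y) :=
  forall B : set X, bounded_set B -> precompact (A @` B).

Definition eproper {X : hilbertType R} (g : X -> \bar R) :=
  (forall x, g x != -oo%E) /\ (exists x, g x \is a fin_num).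

Definition econvex {X : hilbertType R} (g : X -> \bar R) :=
  forall (x y : X) (t : R), 0 < t < 1 ->
    (g (t *: x + (1 - t) *: y)%R <= t%:E * g x + (1 - t)%:E * g y)%E.

Definition argmin {X : Type} (F : X -> \bar R) : set X :=
  [set y | forall z, (F y <= F z)%E].

(* For proper lower semicontinuous convex f, the argmin is a singleton. *)
Definition prox {X : hilbertType R} (f : X -> \bar R) (x : X) : X :=
  xget 0 (argmin (fun y => (f y + (2^-1 * `|x - y| ^+ 2)%:E)%E)).

(* The library's norm on a product is the max norm. *)
Definition pair_norm {X : hilbertType R} (u : X * X) : R :=
  Num.sqrt (`|u.1| ^+ 2 + `|u.2| ^+ 2).

Definition is_lipschitz_constant {X : hilbertType R} (L : R)
    (S : X * X -> X * X) :=
  0 <= L /\ forall u w, pair_norm (S u - S w) <= L * pair_norm (u - w).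

End Hilbert_notions.

Section function_spaces.
Context {R : realType}.
Local Notation mu := (@lebesgue_measure R).
Local Notation I01 := (`]0, 1[%classic : set R).

(* x |-> r x makes X a space of functions on ]0, 1[, where functions that are
   equal almost everywhere are identified, as in L^2(0, 1); r x is a chosen
   representative of the class. *)
Definition function_space_on01 {X : hilbertType R} (r : X -> R -> R) :=
  [/\ forall x, measurable_fun I01 (r x),
      forall (a : R) (x y : X), r (a *: x + y) =
        (fun s => a * r x s + r y s) %[ae mu in I01] &
      forall x y, r x = r y %[ae mu in I01] -> x = y].

Definition L2_kernel (k : R * R -> R) :=
  (k \_ ((`[0, 1]%classic : set R) `*` (`[0, 1]%classic : set R)))
    \in Lfun (mu \x mu)%E 2%:E.

Definition integral_operator {X Y : hilbertType R}
    (rX : X -> R -> R) (rY : Y -> R -> R) (k : R * R -> R) (T : X -> Y) :=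
  forall x, \forall t \ae mu, I01 t ->
    mu.-integrable I01 (fun s => (k (t, s) * rX x s)%:E) /\
    rY (T x) t = \int[mu]_(s in I01) (k (t, s) * rX x s).

End function_spaces.

Section network.
Context {R : realType} {X Y Z : hilbertType R}.
Variables (T : X -> Y) (D : X -> Z) (g : X -> \bar R).
Variables lam mu tau eta : nat -> R.

Definition layerR (n : nat) : X -> X :=
  prox (fun x => ((lam n * mu n)%:E * g x)%E).

Definition layerW (n : nat) (x : X) : X :=
  x - lam n *: adjoint T (T x) - (lam n * tau n) *: adjoint D (D x).

Definition layerU (n : nat) (u : X * X) : X * X :=
  (layerW n u.1 + lam n *: u.2, eta n *: u.2).

Definition layerQ (n : nat) (u : X * X) : X * X := (layerR n u.1, u.2).

Fixpoint virtual_network (m : nat) (u : X * X) : X * X :=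
  if m is n.+1 then layerQ n.+1 (layerU n.+1 (virtual_network n u)) else u.

End network.

Section constants.
Context {R : realType}.
Variables (lam tau eta betaT betaD : nat -> R).

Definition beta (n p : nat) : R := 1 - lam n * (betaT p + tau n * betaD p).

Definition beta_prod (i n p : nat) : R := \prod_(i <= j < n.+1) beta j p.

(* For i >= 1, eta_prod i i.-1 is an empty product, hence 1. *)
Definition eta_prod (i j : nat) : R := \prod_(i <= l < j.+1) eta l.

Definition beta_tilde (i n p : nat) : R :=
  \sum_(i <= j < n) beta_prod j.+1 n p * lam j * eta_prod i j.-1
  + lam n * eta_prod i n.-1.

Definition a_const (i n : nat) : R :=
  2^-1 * sup (range (fun p : nat =>
    let s := beta_prod i n p ^+ 2 + beta_tilde i n p ^+ 2
             + eta_prod i n ^+ 2 in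
    s + Num.sqrt (s ^+ 2 - 4 * beta_prod i n p ^+ 2 * eta_prod i n ^+ 2))).

End constants.

(* Main.v *)
Require Import Defs.
From mathcomp Require Import all_boot all_order all_algebra.
From mathcomp Require Import all_classical all_reals all_analysis.
From mathcomp Require Import ring lra.
Set Implicit Arguments.
Unset Strict Implicit.
Unset Printing Implicit Defensive.
Import Order.TTheory GRing.Theory Num.Theory.
Import numFieldNormedType.Exports.
Local Open Scope classical_set_scope.
Local Open Scope ring_scope.

(** The reflection [2 Q_n - Id] is nonexpansive, because proximity operators are
    firmly nonexpansive. Let [d_n] be the difference of the outputs of the first
    [n] layers for two inputs. Then [D_n = 2^n d_n] satisfies
    [D_n = U_n D_(n-1) + s_n] with [|s_n| <= |U_n D_(n-1)|], and unfolding this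
    recurrence into [U_n D_(n-1) = \sum_(i < n) U_n ... U_(i+1) s_i], with
    [s_0 = d_0], gives [|U_n D_(n-1)| <= theta_n |d_0|] by induction as soon as
    [|U_n ... U_i| <= sqrt a_(i,n)]. The last bound is checked coordinatewise in
    the basis [v]: on the [p]-th coordinates, [U_n ... U_i] acts as the matrix
    [[beta_(i,n,p), beta~_(i,n,p)], [0, eta_(i,n)]], and the quantity whose
    supremum is [a_(i,n)] is the square of the spectral norm of that matrix.
    The last layer only needs [Q_m] nonexpansive, hence the power [m - 1]. *)

(** * Hilbert spaces and proximity operators *)

Section inner_product.
Context {R : realType} {X : hilbertType R}.
Implicit Types x y z : X.

Lemma innerC x y : inner x y = inner y x.
Proof. by rewrite hermC /= expr0 mul1r. Qed.

Lemma innerDl x y z : inner (x + y) z = inner x z + inner y z.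
Proof. exact: linearDl. Qed.

Lemma innerBl x y z : inner (x - y) z = inner x z - inner y z.
Proof. exact: linearBl. Qed.

Lemma innerNl x y : inner (- x) y = - inner x y.
Proof. exact: linearNl. Qed.

Lemma innerZl (a : R) x y : inner (a *: x) y = a * inner x y.
Proof. exact: linearZl_LR. Qed.

Lemma inner0l y : inner 0 y = 0 :> R.
Proof. exact: linear0l. Qed.

Lemma inner_suml (I : Type) (s : seq I) (P : pred I) (F : I -> X) y :
  inner (\sum_(i <- s | P i) F i) y = \sum_(i <- s | P i) inner (F i) y.
Proof. by elim/big_rec2: _ => [|i u w _ <-]; rewrite ?inner0l ?innerDl. Qed.

Lemma innerDr x y z : inner z (x + y) = inner z x + inner z y.
Proof. by rewrite !(innerC z) innerDl. Qed.

Lemma innerBr x y z : inner z (x - y) = inner z x - inner z y.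
Proof. by rewrite !(innerC z) innerBl. Qed.

Lemma innerZr (a : R) x y : inner y (a *: x) = a * inner y x.
Proof. by rewrite !(innerC y) innerZl. Qed.

Lemma sqr_normB x y : `|x - y| ^+ 2 = `|x| ^+ 2 - 2 * inner x y + `|y| ^+ 2.
Proof. rewrite -!innerE !innerBl !innerBr (innerC y x); ring. Qed.

(** Strong convexity of the squared norm, in exact form; [t = 1/2] is the parallelogram identity. *)
Lemma sqr_norm_convex (t : R) x y :
  `|t *: x + (1 - t) *: y| ^+ 2 =
  t * `|x| ^+ 2 + (1 - t) * `|y| ^+ 2 - t * (1 - t) * `|x - y| ^+ 2.
Proof.
rewrite sqr_normB -!innerE !innerDl !innerDr !innerZl !innerZr (innerC y x).
ring.
Qed.

End inner_product.

(** * Proximity operators: existence of minimizers and firm nonexpansiveness *)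

Section prox.
Context {R : realType} {X : hilbertType R}.
Variable f : X -> \bar R.
Hypotheses (fpr : eproper f) (flsc : lower_semicontinuous f)
  (fcvx : econvex f).

(* Near [y0], lower semicontinuity bounds [f] from below by [f y0 - 1];
   convexity on the segment from [y0] to [y] turns this into a bound at [y]
   with a loss linear in [|y - y0|]. *)
Lemma lsc_convex_minorant :
  exists (y0 : X) (a c : R), forall y, ((a - c * `|y - y0|)%:E <= f y)%E.
Proof.
case: fpr => fNy [y0 /fineK y0fin]; set f0 := fine (f y0) in y0fin.
have [|V V0 fV] := @flsc y0 (f0 - 1); first by rewrite -y0fin lte_fin; lra.
have [e /= e0 eV] := (nbhs_ballP _ _).1 V0.
exists y0, (f0 - 1), (2 / e) => y.
have c0 : 0 < 2 / e by rewrite divr_gt0.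
have [lty|ley] := ltP `|y - y0| e.
  apply: (@le_trans _ _ (f0 - 1)%:E); first by
    rewrite lee_fin gerBl mulr_ge0 // ltW.
  by apply/ltW/fV/eV; rewrite -ball_normE /= distrC.
case fy : (f y) => [b| |]; [| by rewrite leey | by move: (fNy y); rewrite fy].
rewrite lee_fin; set r := `|y - y0| in ley *.
have r0 : 0 < r by exact: lt_le_trans ley.
(* This ratio puts the point of the segment at distance [e / 2] from [y0], inside the ball where
   [f > f0 - 1]; the slope [2 / e] comes from [1 / t = (2 / e) * r]. *)
pose t := e / (2 * r).
have t0 : 0 < t by rewrite divr_gt0 // mulr_gt0.
have t1 : t < 1 by rewrite ltr_pdivrMr ?mulr_gt0 //; lra.
have := @fcvx y y0 t; rewrite t0 t1 => /(_ isT).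
have : ((f0 - 1)%:E < f (t *: y + (1 - t) *: y0)%R)%E.
  apply/fV/eV; rewrite -ball_normE /= distrC.
  rewrite scalerBl scale1r addrCA [_ - y0]addrC addKr -scalerBr normrZ.
  rewrite gtr0_norm // -/r /t.
  have -> : e / (2 * r) * r = e / 2 by field; rewrite lt0r_neq0.
  by lra.
rewrite fy -y0fin => /lt_le_trans h/h; rewrite lte_fin => {}h.
have tE : t * (2 / e * r) = 1 by rewrite /t; field; rewrite !lt0r_neq0.
rewrite -(ler_pM2l t0) mulrBr tE; nra.
Qed.

(** The quadratic term absorbs the linear loss of the minorant, since
    [|c| |x - y| <= (|x - y|^2 + |c|^2) / 2]. *)
Lemma prox_objective_lbound (x : X) :
  exists d : R, forall y, (d%:E <= f y + (2^-1 * `|x - y| ^+ 2)%:E)%E.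
Proof.
have [y0 [a [c fac]]] := lsc_convex_minorant.
exists (a - `|c| * `|x - y0| - `|c| ^+ 2 / 2) => y.
apply: le_trans (leeD2r _ (fac y)); rewrite -EFinD lee_fin.
have cc : c * `|y - y0| <= `|c| * `|y - y0| by rewrite ler_wpM2r // ler_norm.
have : `|y - y0| <= `|x - y| + `|x - y0| by rewrite (distrC x) ler_distD.
move=> /(ler_wpM2l (normr_ge0 c)).
have := sqr_ge0 (`|x - y| - `|c|).
nra.
Qed.

(** [xget] returns a minimizer as soon as one exists. One is the limit of a minimizing sequence:
    completeness gives the limit, lower semicontinuity its minimality. *)
Lemma prox_argmin (x : X) :
  argmin (fun y => f y + (2^-1 * `|x - y| ^+ 2)%:E)%E (prox f x).
Proof.
apply: xgetPex.
pose F y := (f y + (2^-1 * `|x - y| ^+ 2)%:E)%E.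
change (exists y, argmin F y).
have [d0 Fd0] := prox_objective_lbound x.
pose S := [set r : R | exists y, F y = r%:E].
have [fNy [y0 y0fin]] := fpr.
have Sinf : has_inf S.
  split; last by exists d0 => r [y Fy]; rewrite -lee_fin -Fy; exact: Fd0.
  by exists (fine (F y0)), y0; rewrite fineK // fin_numD y0fin.
pose d := inf S.
have dF y : (d%:E <= F y)%E.
  case Fy : (F y) => [r| |]; [|by rewrite leey|by move: (Fd0 y); rewrite -/(F y) Fy].
  by rewrite lee_fin; apply: ge_inf; [exact: Sinf.2 | exists y].
have /choice[y yP] n : exists y, (F y <= (d + n.+1%:R^-1)%:E)%E.
  have [|r [y Fy] rd] := @inf_adherent _ S n.+1%:R^-1 _ Sinf; first by [].
  by exists y; rewrite Fy lee_fin ltW.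
(* The parallelogram identity makes the minimizing sequence [y] Cauchy. *)
have mid n k : `|y n - y k| ^+ 2 <= 4 * (n.+1%:R^-1 + k.+1%:R^-1).
  have := @fcvx (y n) (y k) 2^-1; rewrite invr_gt0 invf_lt1 ?ltr1n ?ltr0n //.
  move=> /(_ isT) cvx.
  have := dF (2^-1 *: y n + (1 - 2^-1) *: y k); rewrite /F.
  move: cvx (yP n) (yP k); rewrite /F.
  have -> : x - (2^-1 *: y n + (1 - 2^-1) *: y k) =
            2^-1 *: (x - y n) + (1 - 2^-1) *: (x - y k).
    rewrite !scalerBr addrACA -scalerDl (_ : 2^-1 + (1 - 2^-1) = 1) ?scale1r; last by lra.
    by rewrite opprD.
  rewrite sqr_norm_convex (_ : x - y n - (x - y k) = y k - y n); last first.
    by rewrite opprB addrC addrA subrK.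
  rewrite (distrC (y k)).
  case: (f (y n)) (fNy (y n)) => [a| |//] _; last by rewrite addye.
  case: (f (y k)) (fNy (y k)) => [b| |//] _; last by rewrite [(+oo + _)%E]addye.
  case: (f _) (fNy (2^-1 *: y n + (1 - 2^-1) *: y k)) => [c| |//] _; last by [].
  rewrite -!EFinD !lee_fin.
  move: (n.+1%:R^-1) (k.+1%:R^-1) (`|y n - y k| ^+ 2) => en ek r.
  move: (`|x - y n| ^+ 2) (`|x - y k| ^+ 2) => rn rk h1 h2 h3 h4.
  lra.
have cy : cvgn y.
  apply/cauchy_cvgP/cauchy_ballP => e e0.  near_simpl.
  (* Two tails below [e^2 / 8], times the factor 4 of [mid], stay below [e^2]. *)
  have e8 : 0 < e ^+ 2 / 8 by rewrite divr_gt0 // exprn_gt0.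
  near=> n k; rewrite -ball_normE /=.
  suff : `|y n - y k| ^+ 2 < e ^+ 2 by rewrite ltr_pXn2r ?nnegrE // ltW.
  apply: le_lt_trans (mid _ _) _.
  have n1 : (n).+1%:R^-1 < e ^+ 2 / 8.
    by near: n; exact: (near_infty_natSinv_lt (PosNum e8)).
  have n2 : (k).+1%:R^-1 < e ^+ 2 / 8.
    by near: k; exact: (near_infty_natSinv_lt (PosNum e8)).
  move: (n.+1%:R^-1) (k.+1%:R^-1) n1 n2 => en ek n1 n2.
  by lra.
pose l := limn y; pose q z := 2^-1 * `|x - z| ^+ 2.
have qy : q (y n) @[n --> \oo] --> q l.
  apply: cvgMr; rewrite !expr2; apply: cvgM; apply: cvg_norm; exact: cvgB (cvg_cst _) cy.
exists l => z; apply: le_trans (dF z).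
rewrite leNgt; apply/negP => dFl.
(* A real [a] strictly between [d - q l] and [f l] also covers the case [f l = +oo]. *)
have [a [da al]] : exists a : R, d < a + q l /\ (a%:E < f l)%E.
  move: dFl; rewrite /F -/(q l).
  case: (f l) (fNy l) => [b| |//] _; last by exists (d - q l + 1); split; [lra|exact: ltry].
  rewrite -EFinD lte_fin => dbl; exists ((d - q l + b) / 2); rewrite lte_fin.
  by split; lra.
have [V Vl fV] := flsc al.
(* Half of the gap: for large [n], the objective at [y n] exceeds [a + q l - e = d + e], hence
   [d + 1/(n+1)], against the choice of [y n]. *)
pose e := (a + q l - d) / 2.
have e0 : 0 < e by rewrite /e; lra.
suff : \forall n \near \oo, False by case=> N _ /(_ N (leqnn N)).
near=> n.
have : (a%:E < f (y n))%E by apply: fV; near: n; exact: cy.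
have : `|q l - q (y n)| < e by near: n; move: (e) e0; apply/cvgrPdist_lt; exact: qy.
have : n.+1%:R^-1 < e by near: n; exact: (near_infty_natSinv_lt (PosNum e0)).
move: (yP n); rewrite /F -/(q (y n)).
case: (f (y n)) (fNy (y n)) => [b| |//] _; last by rewrite addye.
rewrite -EFinD lee_fin lte_fin ltr_norml /e => h1 h2 /andP[h3 h4] h5.
by clear dFl al; move: (n.+1%:R^-1) (q (y n)) (q l) da h1 h2 h3 h4 => u v w *; lra.
Unshelve. all: by end_near. Qed.

Lemma prox_fin_num x : f (prox f x) \is a fin_num.
Proof.
have [fNy [y0 y0fin]] := fpr; have := prox_argmin x y0.
rewrite -(fineK y0fin) -EFinD.
by case: (f (prox f x)) (fNy (prox f x)) => // _; rewrite addye // leye_eq.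
Qed.

(** Optimality condition: [x - prox f x] is a subgradient of [f] at [prox f x]. Comparing the
    objective there with its value on the segment towards [z] leaves an error of order [t]. *)
Lemma prox_variational x z : f z \is a fin_num ->
  fine (f (prox f x)) + inner (x - prox f x) (z - prox f x) <= fine (f z).
Proof.
set p := prox f x => zfin.
set fp := fine (f p); set fz := fine (f z).
set ip := inner _ _; pose w := `|z - p| ^+ 2.
have lin t : 0 < t -> t < 1 -> fp + ip <= fz + t * (w / 2).
  move=> t0 t1; have := @fcvx z p t; rewrite t0 t1 => /(_ isT).
  have := prox_argmin x (t *: z + (1 - t) *: p); rewrite -/p.
  rewrite -(fineK zfin) -(fineK (prox_fin_num x)) -/p -/fp -/fz.
  case: (f _) (fpr.1 (t *: z + (1 - t) *: p)) => [c| |//] _; last by [].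
  have -> : x - (t *: z + (1 - t) *: p) = (x - p) - t *: (z - p).
    by rewrite scalerBl scale1r scalerBr addrCA -addrA -opprD.
  rewrite (sqr_normB (x - p)) innerZr -/ip normrZ exprMn real_normK ?num_real // -/w.
  rewrite -!EFinD !lee_fin => h1 h2.
  rewrite -(ler_pM2l t0); nra.
have w0 : 0 <= w by rewrite sqr_ge0.
rewrite leNgt; apply/negP => lt_fz.
(* Instead of letting [t] tend to 0: if the claim fails by [d > 0], then [t = d / (w + d + 1)] gives
   [t * (w / 2) < d], against [lin]. *)
pose d := fp + ip - fz; have d0 : 0 < d by rewrite /d; lra.
have wd0 : 0 < w + d + 1 by lra.
have := lin (d / (w + d + 1)); rewrite divr_gt0 // ltr_pdivrMr // mul1r.
have -> : d < w + d + 1 by lra.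
move=> /(_ isT isT); rewrite -lerBlDl => dle.
have : d * (w + d + 1) <= d * (w / 2).
  rewrite -ler_pdivlMr // mulrAC; exact: dle.
rewrite ler_pM2l //; lra.
Qed.

(** Sum of two variational inequalities, each tested at the other proximal point; the values of [f]
    cancel. *)
Lemma prox_firmly_nonexpansive x y :
  `|prox f x - prox f y| ^+ 2 <= inner (x - y) (prox f x - prox f y).
Proof.
have := prox_variational x (prox_fin_num y).
have := prox_variational y (prox_fin_num x).
rewrite -innerE !(innerBl, innerBr).
have := innerC (prox f x) (prox f y).
lra.
Qed.

(** In the expanded square, what is added to [|x - y|^2] is four times the defect of firm
    nonexpansiveness, which is nonpositive. *)
Lemma prox_reflection_nonexpansive x y :
  `|2 *: (prox f x - prox f y) - (x - y)| <= `|x - y|.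
Proof.
rewrite -ler_sqr ?nnegrE // sqr_normB normrZ innerZl exprMn normr_nat innerC.
have := prox_firmly_nonexpansive x y; lra.
Qed.

End prox.

Section positive_scaling.
Context {R : realType} {X : hilbertType R}.
Variables (c : R) (g : X -> \bar R).
Hypothesis c0 : 0 < c.

Lemma eproperZ : eproper g -> eproper (fun x => c%:E * g x)%E.
Proof.
move=> [gNy [x gx]]; split; last by exists x; rewrite fin_numM.
move=> y; case: (g y) (gNy y) => [r| |] // _.
by rewrite gt0_muley ?lte_fin.
Qed.

Lemma lower_semicontinuousZ :
  lower_semicontinuous g -> lower_semicontinuous (fun x => c%:E * g x)%E.
Proof.
move=> glsc x a; rewrite -lte_pdivrMl // -EFinM => /glsc[V Vx gV].
by exists V => // y /gV; rewrite EFinM lte_pdivrMl.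
Qed.

(** Properness excludes the value [-oo], so no sum [+oo - oo] obstructs distributivity. *)
Lemma econvexZ : eproper g -> econvex g -> econvex (fun x => c%:E * g x)%E.
Proof.
move=> [gNy _] gcvx x y t t01; have /andP[t0 t1] := t01.
have c0' : (0 <= c%:E)%E by rewrite lee_fin ltW.
have t1' : 0 < 1 - t by rewrite subr_gt0.
apply: (le_trans (lee_wpmul2l c0' (gcvx x y t t01))).
rewrite muleDr //; first by rewrite !muleA -!EFinM !(mulrC c).
case: (g x) (gNy x) => [r| |] // _; case: (g y) (gNy y) => [s| |] // _;
by rewrite ?gt0_muley ?lte_fin.
Qed.

End positive_scaling.

(** * The Hilbert norm on the product space *)

Section pair_norm.
Context {R : realType} {X : hilbertType R}.
Implicit Types u w : X * X.

Lemma pair_norm_ge0 u : 0 <= pair_norm u.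
Proof. exact: sqrtr_ge0. Qed.

Lemma sqr_pair_norm u : pair_norm u ^+ 2 = `|u.1| ^+ 2 + `|u.2| ^+ 2.
Proof. by rewrite sqr_sqrtr // addr_ge0 // sqr_ge0. Qed.

Lemma ler_pair_norm_sqr u (a : R) :
  0 <= a -> (pair_norm u <= a) = (`|u.1| ^+ 2 + `|u.2| ^+ 2 <= a ^+ 2).
Proof. by move=> a0; rewrite -sqr_pair_norm ler_sqr ?nnegrE ?pair_norm_ge0. Qed.

Lemma pair_norm0 : pair_norm (0 : X * X) = 0.
Proof. by rewrite /pair_norm /= normr0 expr0n addr0 sqrtr0. Qed.

Lemma pair_normZ (a : R) u : pair_norm (a *: u) = `|a| * pair_norm u.
Proof.
by rewrite /pair_norm /= !normrZ !exprMn -mulrDr sqrtrM ?sqr_ge0 ?sqrtr_sqr ?normr_id.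
Qed.

(** After squaring, this is the Cauchy-Schwarz inequality in the plane for the norms of the
    components. *)
Lemma pair_normD u w : pair_norm (u + w) <= pair_norm u + pair_norm w.
Proof.
rewrite ler_pair_norm_sqr ?addr_ge0 ?pair_norm_ge0 // sqrrD !sqr_pair_norm /=.
have sqrD (V : normedModType R) (x y : V) : `|x + y| ^+ 2 <= (`|x| + `|y|) ^+ 2.
  by rewrite lerXn2r ?nnegrE ?addr_ge0 // ler_normD.
have := sqrD _ u.1 w.1; have := sqrD _ u.2 w.2 => h2 h1.
suff : `|u.1| * `|w.1| + `|u.2| * `|w.2| <= pair_norm u * pair_norm w by nra.
rewrite -ler_sqr ?nnegrE ?addr_ge0 ?mulr_ge0 ?pair_norm_ge0 //.
rewrite exprMn !sqr_pair_norm.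
have := sqr_ge0 (`|u.1| * `|w.2| - `|u.2| * `|w.1|); nra.
Qed.

Lemma pair_norm_sum (I : Type) (s : seq I) (P : pred I) (F : I -> X * X) :
  pair_norm (\sum_(i <- s | P i) F i) <= \sum_(i <- s | P i) pair_norm (F i).
Proof.
elim/big_rec2: _ => [|i y x _ le]; first by rewrite pair_norm0.
by apply: le_trans (pair_normD _ _) _; rewrite lerD2l.
Qed.

End pair_norm.

(** * Unfolding the perturbed recurrence along compositions of layers *)

Section layer_compositions.
Context {R : realType} {X : hilbertType R}.
Variable L : nat -> X * X -> X * X.

(** The range is half-open: [compose_layers i n.+1] applies [L i] first and [L n] last, and equal
    bounds give the identity. *)
Definition compose_layers (i n : nat) (u : X * X) : X * X :=
  foldl (fun w j => L j w) u (index_iota i n).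

Lemma compose_layers_nil n u : compose_layers n n u = u.
Proof. by rewrite /compose_layers /index_iota subnn. Qed.

Lemma compose_layersS i n u : (i <= n)%N ->
  compose_layers i n.+1 u = L n (compose_layers i n u).
Proof.
by move=> lein; rewrite /compose_layers /index_iota subSn // -addn1 iotaD foldl_cat /= subnKC.
Qed.

Variables (m : nat) (C : nat -> nat -> R) (theta : nat -> R).
Hypotheses (Ladd : forall n, {morph L n : u w / u + w})
  (C0 : forall i n, 0 <= C i n)
  (LC : forall i n u, (1 <= i <= n)%N -> (n <= m)%N ->
     pair_norm (compose_layers i n.+1 u) <= C i n * pair_norm u)
  (theta0 : theta 0%N = 1)
  (thetaE : forall n, (1 <= n <= m)%N ->
     theta n = \sum_(1 <= i < n.+1) theta i.-1 * C i n).

Let layer_sum n (I : Type) (s : seq I) (P : pred I) (F : I -> X * X) :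
  L n (\sum_(i <- s | P i) F i) = \sum_(i <- s | P i) L n (F i).
Proof.
apply: (big_morph (L n) (Ladd n)).
by apply: (addrI (L n 0)); rewrite -Ladd !addr0.
Qed.

Lemma theta_ge0 n : (n <= m)%N -> 0 <= theta n.
Proof.
elim/ltn_ind: n => -[|n] IH nm; first by rewrite theta0.
rewrite thetaE // big_seq; apply: sumr_ge0 => -[|i]; rewrite mem_index_iota // => /andP[_].
by rewrite ltnS => lt_in; rewrite mulr_ge0 ?C0 ?IH // ltnW // (leq_trans lt_in).
Qed.

Variable d : nat -> X * X.
Hypothesis dL : forall n, (n < m)%N ->
  pair_norm (d n.+1 - L n.+1 (d n)) <= pair_norm (L n.+1 (d n)).

(** The perturbations of the recurrence; the initial value counts as the one of index 0, so that the
    expansion is a single sum. *)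
Let r n := if n is n'.+1 then d n - L n (d n') else d 0%N.

Lemma unfold_recurrence n :
  d n = \sum_(0 <= i < n.+1) compose_layers i.+1 n.+1 (r i).
Proof.
elim: n => [|n IH]; first by rewrite big_nat1 compose_layers_nil.
rewrite big_nat_recr //= compose_layers_nil.
under eq_big_nat => i /andP[_ lt_in] do rewrite compose_layersS //.
by rewrite -layer_sum -IH addrC subrK.
Qed.

(** By strong induction, [dL] bounds [r i] by [theta i * pair_norm (d 0)]; summing the expansion
    then reproduces the recursion of [theta]. *)
Lemma recurrence_bound n : (n < m)%N ->
  pair_norm (L n.+1 (d n)) <= theta n.+1 * pair_norm (d 0%N).
Proof.
elim/ltn_ind: n => n IH nm.
have rb i : (i <= n)%N -> pair_norm (r i) <= theta i * pair_norm (d 0%N).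
  case: i => [|i] lt_in; first by rewrite theta0 mul1r.
  have im : (i < m)%N by exact: ltn_trans nm.
  exact: le_trans (dL im) (IH _ lt_in im).
rewrite unfold_recurrence layer_sum.
apply: le_trans (pair_norm_sum _ _ _) _.
(* The shift of index pairs [theta i], formerly [theta i.-1], with [r i]. *)
rewrite thetaE // big_add1 mulr_suml; apply: ler_sum_nat => i /andP[_ lt_in].
rewrite -compose_layersS //.
apply: le_trans (LC _ _ _) _ => //.
rewrite mulrAC mulrC; apply: ler_wpM2r; first exact: C0.
exact: rb.
Qed.

End layer_compositions.

(** * Diagonal operators *)

Section gram_operator.
Context {R : realType} {X Y : hilbertType R}.
Variables (A : X -> Y) (v : nat -> X) (b : nat -> R).
Hypotheses (vortho : forall p q, inner (v p) (v q) = (p == q)%:R :> R)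
  (Av : forall p, adjoint A (A (v p)) = b p *: v p).

(* Without an adjoint, [adjoint A] is constantly zero, and so is [b]. *)
Lemma adjoint_spec_or_zero :
  (forall x y, inner (A x) y = inner x (adjoint A y)) \/
  ((forall y, adjoint A y = 0) /\ forall p, b p = 0).
Proof.
have [[B AB]|nB] := pselect (exists B : Y -> X, forall x y, inner (A x) y = inner x (B y)).
  left; suff : [set C : Y -> X | forall x y, inner (A x) y = inner x (C y)]
    (adjoint A) by [].
  by apply: xgetPex; exists B.
have A0 : adjoint A = fun=> 0.
  by apply: xgetPN => B AB; apply: nB; exists B.
right; split=> [y|p]; first by rewrite A0.
have := congr1 (inner^~ (v p)) (Av p); rewrite A0 inner0l innerZl vortho eqxx.
by rewrite mulr1.
Qed.

(** [A^* A] is symmetric and [v p] is an eigenvector. *)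
Lemma inner_gram x p : inner (adjoint A (A x)) (v p) = b p * inner x (v p).
Proof.
have [adjA|[A0 ->]] := adjoint_spec_or_zero; last by rewrite A0 inner0l mul0r.
by rewrite innerC -adjA innerC adjA Av innerZr.
Qed.

(** The eigenvalue is [|A (v p)|^2] if an adjoint exists, and 0 otherwise. *)
Lemma gram_eigenvalue_le (M : R) p : `|A (v p)| <= M -> `|b p| <= M ^+ 2.
Proof.
move=> AM; have M0 : 0 <= M by exact: le_trans AM.
have [adjA|[_ ->]] := adjoint_spec_or_zero; last by rewrite normr0 sqr_ge0.
have -> : b p = `|A (v p)| ^+ 2.
  by rewrite -innerE adjA Av innerZr vortho eqxx mulr1.
by rewrite normrX normr_id lerXn2r ?nnegrE.
Qed.

End gram_operator.

Lemma compact_operator_bounded (R : realType) (X Y : hilbertType R) (A : X -> Y) :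
  compact_operator A -> exists M : R, forall x, `|x| <= 1 -> `|A x| <= M.
Proof.
move=> cA; have := cA [set x | `|x| <= 1].
rewrite precompactE => /(_ _)/compact_bounded[].
  by exists 1; split=> // M M1 x /= x1; exact: le_trans x1 (ltW M1).
move=> M [_ AM]; exists (M + 1) => x x1.
apply: (AM (M + 1)); first by rewrite ltrDl.
by apply: subset_closure; exists x.
Qed.

Section orthonormal_expansion.
Context {R : realType} {X : hilbertType R}.
Variable v : nat -> X.
Hypothesis hv : orthonormal_basis v.

Lemma coord_inj x y : (forall p, inner x (v p) = inner y (v p)) -> x = y.
Proof.
move=> xy; apply: (@cvg_unique X _ (series (fun p => inner x (v p) *: v p) @ \oo)).
- exact: norm_hausdorff.
- exact: hv.2.
- have -> : (fun p => inner x (v p) *: v p) = (fun p => inner y (v p) *: v p).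
    by apply/funext => p; rewrite xy.
  exact: hv.2.
Qed.

(** By Pythagoras, the partial sums are the squared norms of the partial expansions of [x]. *)
Lemma parseval x : series (fun p => inner x (v p) ^+ 2) @ \oo --> `|x| ^+ 2.
Proof.
have -> : series (fun p => inner x (v p) ^+ 2) =
          fun n => `|series (fun p => inner x (v p) *: v p) n| ^+ 2.
  apply/funext; rewrite /series /=; elim=> [|n IH].
    by rewrite !big_geq // normr0 expr0n.
  rewrite !big_nat_recr //= IH -!innerE innerDl !innerDr.
  set S := \sum_(0 <= i < n) _.
  have Sv : inner S (v n) = 0.
    rewrite inner_suml big_seq big1 // => i; rewrite mem_index_iota => lt_in.
    by rewrite innerZl hv.1 ltn_eqF // mulr0.
  rewrite !(innerZl, innerZr) (innerC (v n) S) Sv hv.1 eqxx.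
  by rewrite mulr1n; ring.
have /(_ _) nx := cvg_norm (hv.2 x); exact: (cvgM nx nx).
Qed.

End orthonormal_expansion.

(** For [M = [[b, t], [0, e]]], the matrix [M^T M] has trace [s] and determinant [b^2 e^2]; the
    factor on the right is its largest eigenvalue. *)
Lemma triangular_mx_norm (R : rcfType) (b t e x y : R) :
  let s := b ^+ 2 + t ^+ 2 + e ^+ 2 in
  (b * x + t * y) ^+ 2 + (e * y) ^+ 2 <=
  2^-1 * (s + Num.sqrt (s ^+ 2 - 4 * b ^+ 2 * e ^+ 2)) * (x ^+ 2 + y ^+ 2).
Proof.
cbv zeta; set s := b ^+ 2 + t ^+ 2 + e ^+ 2; set D := s ^+ 2 - _; set r := Num.sqrt D.
have D0 : 0 <= D.
  have -> : D = (t ^+ 2 + (b - e) ^+ 2) * (t ^+ 2 + (b + e) ^+ 2).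
    by rewrite /D /s; ring.
  by rewrite mulr_ge0 // addr_ge0 // sqr_ge0.
have r0 : 0 <= r by exact: sqrtr_ge0.
have r2 : r ^+ 2 = D by rewrite sqr_sqrtr.
(* Diagonal entries of the eigenvalue times the identity minus [M^T M]; the off-diagonal entry is
   [- b * t]. Its determinant vanishes, which is [PQ]. *)
pose P := 2^-1 * (s + r) - b ^+ 2; pose Q := 2^-1 * (s + r) - t ^+ 2 - e ^+ 2.
have PQ : P * Q = (b * t) ^+ 2.
  have : 4 * P * Q = r ^+ 2 - D + 4 * (b * t) ^+ 2 by rewrite /P /Q /D /s; field.
  rewrite r2; lra.
have PDQ : P + Q = r by rewrite /P /Q /s; field.
have P0 : 0 <= P.
  rewrite leNgt; apply/negP => Plt; have : 0 < Q by lra.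
  have := sqr_ge0 (b * t); nra.
have : 0 <= P * x ^+ 2 - 2 * (b * t) * x * y + Q * y ^+ 2.
  (* If [P = 0], the cross term vanishes too; otherwise multiplying by [P] completes the square. *)
  have := P0; rewrite le_eqVlt => /predU1P[P00|P1].
    have bt0 : b * t = 0 by apply/eqP; rewrite -sqrf_eq0 -PQ -P00 mul0r.
    rewrite -P00 bt0; have : 0 <= Q by lra.
    by have := sqr_ge0 y; nra.
  rewrite -(pmulr_rge0 _ P1).
  have -> : P * (P * x ^+ 2 - 2 * (b * t) * x * y + Q * y ^+ 2) =
    (P * x - b * t * y) ^+ 2 + (P * Q - (b * t) ^+ 2) * y ^+ 2 by ring.
  by rewrite PQ subrr mul0r addr0 sqr_ge0.
rewrite /P /Q; lra.
Qed.

(** * Boundedness in [p] and the constants [a_(i,n)] *)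

Section bounded_families.
Context {R : realType} {T : Type}.
Implicit Types f h : T -> R.

Definition bounded_family f := exists M : R, forall p, `|f p| <= M.

Lemma bounded_family_cst (c : R) : bounded_family (fun=> c).
Proof. by exists `|c|. Qed.

Lemma bounded_familyD f h :
  bounded_family f -> bounded_family h -> bounded_family (fun p => f p + h p).
Proof.
move=> [M fM] [N hN]; exists (M + N) => p.
by apply: le_trans (ler_normD _ _) _; exact: lerD.
Qed.

Lemma bounded_familyM f h :
  bounded_family f -> bounded_family h -> bounded_family (fun p => f p * h p).
Proof.
by move=> [M fM] [N hN]; exists (M * N) => p; rewrite normrM ler_pM.
Qed.

Lemma bounded_family_sum (I : Type) (s : seq I) (F : I -> T -> R) :
  (forall i, bounded_family (F i)) ->
  bounded_family (fun p => \sum_(i <- s) F i p).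
Proof.
move=> bF; elim: s => [|i s IH].
  by under eq_fun do rewrite big_nil; exact: bounded_family_cst.
by under eq_fun do rewrite big_cons; exact: bounded_familyD.
Qed.

Lemma bounded_family_prod (I : Type) (s : seq I) (F : I -> T -> R) :
  (forall i, bounded_family (F i)) ->
  bounded_family (fun p => \prod_(i <- s) F i p).
Proof.
move=> bF; elim: s => [|i s IH].
  by under eq_fun do rewrite big_nil; exact: bounded_family_cst.
by under eq_fun do rewrite big_cons; exact: bounded_familyM.
Qed.

End bounded_families.

Section constants.
Context {R : realType}.
Variables lam tau eta betaT betaD : nat -> R.
Local Notation beta := (beta lam tau betaT betaD).
Local Notation beta_prod := (beta_prod lam tau betaT betaD).
Local Notation beta_tilde := (beta_tilde lam tau eta betaT betaD).
Local Notation eta_prod := (eta_prod eta).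
Local Notation a_const := (a_const lam tau eta betaT betaD).

Lemma beta_prodS i n p : (i <= n.+1)%N ->
  beta_prod i n.+1 p = beta_prod i n p * beta n.+1 p.
Proof. by move=> lein; rewrite /Defs.beta_prod big_nat_recr. Qed.

Lemma eta_prodS i n : (i <= n.+1)%N ->
  eta_prod i n.+1 = eta_prod i n * eta n.+1.
Proof. by move=> lein; rewrite /Defs.eta_prod big_nat_recr. Qed.

(** Upper right entry after left multiplication by the matrix [[[beta_(n+1), lam_(n+1)],
    [0, eta_(n+1)]]]. *)
Lemma beta_tildeS i n p : (i <= n)%N ->
  beta_tilde i n.+1 p = beta n.+1 p * beta_tilde i n p + lam n.+1 * eta_prod i n.
Proof.
move=> lein; rewrite /Defs.beta_tilde big_nat_recr //=; congr (_ + _).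
rewrite mulrDr mulr_sumr; congr (_ + _).
  apply: eq_big_nat => j /andP[_ lt_jn].
  by rewrite beta_prodS; [ring | exact: ltnW].
by rewrite /Defs.beta_prod big_nat1 mulrA.
Qed.

Hypotheses (bT : bounded_family betaT) (bD : bounded_family betaD).

Lemma bounded_family_beta_prod i n : bounded_family (beta_prod i n).
Proof.
apply: bounded_family_prod => j.
apply: bounded_familyD; first exact: bounded_family_cst.
rewrite (_ : (fun p => _) = fun p => - lam j * (betaT p + tau j * betaD p)); last first.
  by apply/funext => p; rewrite mulNr.
apply: bounded_familyM; first exact: bounded_family_cst.
apply: bounded_familyD => //.
by apply: bounded_familyM => //; exact: bounded_family_cst.
Qed.

Lemma bounded_family_beta_tilde i n : bounded_family (beta_tilde i n).
Proof.
apply: bounded_familyD; last exact: bounded_family_cst.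
apply: bounded_family_sum => j.
apply: bounded_familyM; last exact: bounded_family_cst.
apply: bounded_familyM; last exact: bounded_family_cst.
exact: bounded_family_beta_prod.
Qed.

(** The supremum dominates its family only if the latter is bounded above; here the square root is
    at most [s], so [2 s] bounds each term, and [s] is bounded in [p]. *)
Lemma a_const_ge i n p :
  let s := beta_prod i n p ^+ 2 + beta_tilde i n p ^+ 2 + eta_prod i n ^+ 2 in
  2^-1 * (s + Num.sqrt (s ^+ 2 - 4 * beta_prod i n p ^+ 2 * eta_prod i n ^+ 2))
    <= a_const i n.
Proof.
rewrite /Defs.a_const ler_pM2l ?invr_gt0 //; apply: ub_le_sup; last by exists p.
pose s q := beta_prod i n q ^+ 2 + beta_tilde i n q ^+ 2 + eta_prod i n ^+ 2.
have [M sM] : bounded_family s.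
  have bb := bounded_family_beta_prod i n; have bt := bounded_family_beta_tilde i n.
  apply: bounded_familyD; last exact: bounded_family_cst.
  by apply: bounded_familyD; [exact: (bounded_familyM bb bb) | exact: (bounded_familyM bt bt)].
exists (M + M) => _ [q _ <-] /=; rewrite -/(s q).
have s0 : 0 <= s q by rewrite !addr_ge0 // sqr_ge0.
apply: le_trans (lerD (sM q) (sM q)); rewrite ger0_norm // lerD2l.
rewrite -[leRHS]ger0_norm // -sqrtr_sqr ler_wsqrtr // lerBlDr lerDl.
by rewrite -mulrA -exprMn pmulr_rge0 ?sqr_ge0.
Qed.

End constants.

(** * Coordinates and norms of compositions of the linear layers *)

Section virtual_layers.
Context {R : realType} {X Y Z : hilbertType R}.
Variables (T : X -> Y) (D : X -> Z) (v : nat -> X) (betaT betaD : nat -> R).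
Variables (lam tau eta : nat -> R).
Hypotheses (hv : orthonormal_basis v)
  (hTv : forall p, adjoint T (T (v p)) = betaT p *: v p)
  (hDv : forall p, adjoint D (D (v p)) = betaD p *: v p)
  (bT : bounded_family betaT) (bD : bounded_family betaD).
Local Notation layerW := (layerW T D lam tau).
Local Notation layerU := (layerU T D lam tau eta).

Lemma inner_layerW n x p :
  inner (layerW n x) (v p) = beta lam tau betaT betaD n p * inner x (v p).
Proof.
rewrite /Defs.layerW !innerBl !innerZl (inner_gram hv.1 hTv) (inner_gram hv.1 hDv).
by rewrite /beta; ring.
Qed.

(** [adjoint] is merely a chosen function, so additivity is read off the coordinates, where [layerW]
    acts by scalars. *)
Lemma layerUD n : {morph layerU n : u w / u + w}.
Proof.
move=> u w; rewrite /Defs.layerU; congr pair; last by rewrite /= scalerDr.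
apply: (coord_inj hv) => p.
by rewrite /= !(innerDl, innerZl, inner_layerW); ring.
Qed.

Lemma layerU_scalerB n (a : R) u w :
  layerU n (a *: (u - w)) = a *: (layerU n u - layerU n w).
Proof.
rewrite /Defs.layerU; congr pair; last first.
  by rewrite /= -scalerBr !scalerA mulrC.
apply: (coord_inj hv) => p.
by rewrite /= !(innerDl, innerNl, innerZl, inner_layerW); ring.
Qed.

Lemma compose_layerU2 i n u : (0 < i <= n)%N ->
  (compose_layers layerU i n.+1 u).2 = eta_prod eta i n *: u.2.
Proof.
case/andP=> i0; elim: n => [|n IH]; first by rewrite leqNgt i0.
move=> lein; rewrite compose_layersS //= eta_prodS //.
move: lein; rewrite leq_eqVlt => /predU1P[->|lein].
  by rewrite compose_layers_nil /eta_prod big_geq ?mul1r.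
by rewrite IH // scalerA mulrC.
Qed.

Lemma inner_compose_layerU i n u p : (0 < i <= n)%N ->
  inner (compose_layers layerU i n.+1 u).1 (v p) =
  beta_prod lam tau betaT betaD i n p * inner u.1 (v p) +
  beta_tilde lam tau eta betaT betaD i n p * inner u.2 (v p).
Proof.
case/andP=> i0; elim: n => [|n IH]; first by rewrite leqNgt i0.
move=> lein; rewrite compose_layersS //= innerDl innerZl inner_layerW.
move: lein; rewrite leq_eqVlt => /predU1P[->|lein].
  rewrite compose_layers_nil /beta_prod big_nat1 /beta_tilde big_geq // add0r.
  by rewrite /eta_prod big_geq // mulr1.
rewrite IH // compose_layerU2 ?i0 // innerZl beta_prodS; last exact: ltnW.
rewrite beta_tildeS //; ring.
Qed.

(** Parseval on both components reduces the bound to a termwise comparison of partial sums, one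
    triangular matrix for each [p]. *)
Lemma pair_norm_compose_layerU i n u : (0 < i <= n)%N ->
  pair_norm (compose_layers layerU i n.+1 u) <=
  Num.sqrt (a_const lam tau eta betaT betaD i n) * pair_norm u.
Proof.
move=> lein; set w := compose_layers _ _ _ _; set a := a_const _ _ _ _ _ _ _.
rewrite mulrC /pair_norm -sqrtrM ?addr_ge0 ?sqr_ge0 // ler_wsqrtr // mulrC.
pose energy (y : X * X) p := inner y.1 (v p) ^+ 2 + inner y.2 (v p) ^+ 2.
have energyE y : series (energy y) @ \oo --> `|y.1| ^+ 2 + `|y.2| ^+ 2.
  rewrite (_ : energy y =
    (fun p => inner y.1 (v p) ^+ 2) + (fun p => inner y.2 (v p) ^+ 2)) //.
  by rewrite seriesD; apply: cvgD; exact: parseval.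
apply: (ler_cvg_to (energyE w)); first exact: cvgMr (energyE u).
apply: nearW => N; rewrite /series /= mulr_sumr; apply: ler_sum => p _.
rewrite /energy inner_compose_layerU // compose_layerU2 // innerZl.
apply: le_trans (triangular_mx_norm _ _ _ _ _) _.
by apply: ler_wpM2r; [rewrite addr_ge0 ?sqr_ge0 | exact: a_const_ge].
Qed.

End virtual_layers.

(** * The nonlinear layers and their reflections *)

Section prox_layer.
Context {R : realType} {X : hilbertType R}.
Variables (g : X -> \bar R) (lam mu : nat -> R) (n : nat).
Hypotheses (gpr : eproper g) (glsc : lower_semicontinuous g) (gcvx : econvex g)
  (lam0 : 0 < lam n) (mu0 : 0 < mu n).
Local Notation Q := (layerQ g lam mu n).

Lemma layerQ_reflection_nonexpansive u w :
  pair_norm (2 *: (Q u - Q w) - (u - w)) <= pair_norm (u - w).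
Proof.
have c0 : 0 < lam n * mu n by rewrite mulr_gt0.
have le1 := prox_reflection_nonexpansive (eproperZ c0 gpr)
  (lower_semicontinuousZ c0 glsc) (econvexZ c0 gpr gcvx) u.1 w.1.
rewrite ler_pair_norm_sqr ?pair_norm_ge0 // sqr_pair_norm /=.
apply: lerD; first by rewrite lerXn2r ?nnegrE.
by rewrite scaler_nat mulr2n addrK.
Qed.

(** [Q] is the average of the identity and its reflection. *)
Lemma layerQ_nonexpansive u w : pair_norm (Q u - Q w) <= pair_norm (u - w).
Proof.
have := pair_normD (2 *: (Q u - Q w) - (u - w)) (u - w).
rewrite subrK pair_normZ normr_nat.
have := layerQ_reflection_nonexpansive u w; lra.
Qed.

End prox_layer.

(** * Lipschitz constant of the virtual network *)

Theorem proposition3p4 (R : realType) (X Y Z : hilbertType R)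
    (rX : X -> R -> R) (rY : Y -> R -> R) (k : R * R -> R)
    (T : {linear X -> Y}) (D : {linear X -> Z})
    (v : nat -> X) (betaT betaD : nat -> R) (g : X -> \bar R)
    (m : nat) (lam mu tau eta theta : nat -> R)
    (hX : function_space_on01 rX) (hY : function_space_on01 rY)
    (hk : L2_kernel k) (hTk : integral_operator rX rY k T)
    (hT : compact_operator T) (hD : bounded_fun_norm D)
    (hcomm : forall x, adjoint T (T (adjoint D (D x))) =
                       adjoint D (D (adjoint T (T x))))
    (hv : orthonormal_basis v)
    (hTv : forall p, adjoint T (T (v p)) = betaT p *: v p)
    (hDv : forall p, adjoint D (D (v p)) = betaD p *: v p)
    (hg_proper : eproper g) (hg_lsc : lower_semicontinuous g)
    (hg_convex : econvex g)
    (hm : (0 < m)%N)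
    (hpos : forall n, (1 <= n <= m)%N ->
       [/\ 0 < lam n, 0 < mu n, 0 < tau n & 0 < eta n])
    (htheta0 : theta 0%N = 1)
    (htheta : forall n, (1 <= n <= m)%N ->
       theta n = \sum_(1 <= i < n.+1)
         theta i.-1 * Num.sqrt (a_const lam tau eta betaT betaD i n)) :
  is_lipschitz_constant (theta m / 2 ^+ m.-1)
    (virtual_network T D g lam mu tau eta m).
Proof.
(* Both spectra are bounded because the [v p] are unit vectors and [T] and [D] are bounded on the
   unit ball. *)
have bT : bounded_family betaT.
  have [M TM] := compact_operator_bounded hT.
  exists (M ^+ 2) => p; apply: (gram_eigenvalue_le hv.1 hTv); apply: TM.
  by rewrite -(@ler_pXn2r _ 2) ?nnegrE // -innerE hv.1 eqxx expr1n.
have bD : bounded_family betaD.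
  have [M DM] := hD 1.
  exists (M ^+ 2) => p; apply: (gram_eigenvalue_le hv.1 hDv); apply: DM.
  by rewrite -(@ler_pXn2r _ 2) ?nnegrE // -innerE hv.1 eqxx expr1n.
pose C i n := Num.sqrt (a_const lam tau eta betaT betaD i n).
have C0 i n : 0 <= C i n by exact: sqrtr_ge0.
split; first by rewrite divr_ge0 ?exprn_ge0 // (theta_ge0 C0 htheta0 htheta).
move=> u w.
pose L := layerU T D lam tau eta.
have LD n : {morph L n : u w / u + w} by exact: (layerUD lam tau eta hv hTv hDv).
have LZB n := layerU_scalerB lam tau eta hv hTv hDv n.
have LC i n (x : X * X) : (1 <= i <= n)%N -> (n <= m)%N ->
    pair_norm (compose_layers L i n.+1 x) <= C i n * pair_norm x.
  by move=> lein _; exact: (pair_norm_compose_layerU lam tau eta hv hTv hDv bT bD).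
pose S := virtual_network T D g lam mu tau eta.
(* The power of 2 clears the factor [1/2] in [Q = (Id + (2 Q - Id)) / 2] at each layer. *)
pose d n := 2 ^+ n *: (S n u - S n w).
have Ld n : L n.+1 (d n) = 2 ^+ n *: (L n.+1 (S n u) - L n.+1 (S n w)).
  exact: LZB.
have dL n : (n < m)%N ->
    pair_norm (d n.+1 - L n.+1 (d n)) <= pair_norm (L n.+1 (d n)).
  move=> nm; have [l0 m0 _ _] := hpos n.+1 nm.
  rewrite Ld /d exprSr -scalerA -scalerBr !pair_normZ ler_wpM2l //.
  exact: layerQ_reflection_nonexpansive.
case: m hm LC dL {hT} hpos htheta => // n _ LC dL hpos' htheta'.
have [l0 m0 _ _] := hpos' n.+1 (leqnn _).
(* With [m = n + 1], the recurrence stops just before [Q_m], where the accumulated factor is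
   [2^n = 2^(m-1)]. *)
have := recurrence_bound LD C0 LC htheta0 htheta' dL (leqnn _).
rewrite Ld /d expr0 scale1r pair_normZ normrX normr_nat => le_e.
apply: le_trans (layerQ_nonexpansive _ _ _ _ _ _ _) _ => //.
by rewrite mulrAC ler_pdivlMr ?exprn_gt0 // mulrC.
Qed.
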